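(* Let $(W_1,\rho_1)$, $(W_2,\rho_2)$ be rational $\mathfrak{sl}(2)$-modules. Then $$\dim_{\mathbb{C}}\mathrm{Hom}_{\mathfrak{sl}(2)}(W_1,W_2)\le \mathrm{length}(W_1)\cdot\mathrm{length}(W_2).$$ Therefore the category $\mathcal R$ of rational $\mathfrak{sl}(2)$-modules is $\mathrm{Hom}_{\mathbb{C}}$-finite (all Hom spaces are finite-dimensional over $\mathbb{C}$).
   Context: $\mathfrak{sl}(2)$ has basis $L_{-1}=f$, $L_0=-\tfrac12 h$, $L_1=-e$ for a Chevalley basis $e,f,h$. An $\mathfrak{sl}(2)$-module is a $\mathbb{C}[z]$-module via $z\cdot v=L_0v$; it is rational if it is, with this structure, a finite-dimensional $\mathbb{C}(z)$-vector space. $\mathcal R$ is the full subcategory of rational modules. For a rational module $W$, $\mathrm{length}(W)$ is the maximal length of a filtration of $W$ by rational $\mathfrak{sl}(2)$-submodules (submodules that are $\mathbb{C}(z)$-subspaces). *)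

(* Defs.v *)
(* The complex numbers C are modelled as R[i] = complex R
   for an arbitrary R : realType (a model of the reals). *)
From HB Require Import structures.
From mathcomp Require Import all_boot all_order all_algebra.
From mathcomp Require Import complex.
From mathcomp Require Import reals.
Set Implicit Arguments. Unset Strict Implicit. Unset Printing Implicit Defensive.
Import Order.TTheory GRing.Theory Num.Theory.
Local Open Scope ring_scope.

Section Sl2.
Variable C : fieldType.
Variable V : lmodType C.

Definition is_sl2_action (e f h : {linear V -> V}) : Prop :=
  [/\ forall v, e (f v) - f (e v) = h v,
      forall v, h (e v) - e (h v) = 2%:R *: e v
    & forall v, h (f v) - f (h v) = - (2%:R *: f v)].

Definition L0 (h : {linear V -> V}) (v : V) : V := - (2%:R^-1 *: h v).

Definition pact (h : {linear V -> V}) (p : {poly C}) (v : V) : V :=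
  \sum_(i < size p) p`_i *: iter i (L0 h) v.

(* rational: the C[z]-module structure extends to a C(z)-vector space
   structure (every nonzero p(L_0) is bijective) which is finite-dimensional
   over C(z): finitely many vectors s_j such that every v has
   q(L_0) v = sum_j p_j(L_0) s_j for some q <> 0. *)
Definition is_rational (h : {linear V -> V}) : Prop :=
  (forall p : {poly C}, p != 0 -> bijective (pact h p)) /\
  exists s : seq V, forall v : V,
    exists (q : {poly C}) (ps : 'I_(size s) -> {poly C}),
      q != 0 /\ pact h q v = \sum_(j < size s) pact h (ps j) s`_j.

(* rational sl(2)-submodule: sl(2)-submodule that is a C(z)-subspace *)
Definition is_rational_submodule (e f h : {linear V -> V}) (S : V -> Prop)
  : Prop :=
  [/\ S 0,
      forall u v, S u -> S v -> S (u + v),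
      forall (c : C) v, S v -> S (c *: v),
      forall v, S v -> S (e v) /\ S (f v) /\ S (h v)
    & forall (p : {poly C}) v, p != 0 -> S (pact h p v) -> S v].

Definition rational_chain (e f h : {linear V -> V}) (n : nat)
  (S : nat -> V -> Prop) : Prop :=
  [/\ forall i, (i <= n)%N -> is_rational_submodule e f h (S i),
      forall v, S 0%N v <-> v = 0,
      forall v, S n v
    & forall i, (i < n)%N ->
        (forall v, S i v -> S i.+1 v) /\ exists v, S i.+1 v /\ ~ S i v].

Definition is_length (e f h : {linear V -> V}) (n : nat) : Prop :=
  (exists S, rational_chain e f h n S) /\
  forall m, (exists S, rational_chain e f h m S) -> (m <= n)%N.

End Sl2.

Section Hom.
Variable C : fieldType.
Variables V1 V2 : lmodType C.

Definition is_sl2_hom (e1 f1 h1 : {linear V1 -> V1})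
  (e2 f2 h2 : {linear V2 -> V2}) (phi : V1 -> V2) : Prop :=
  [/\ forall u v, phi (u + v) = phi u + phi v,
      forall (c : C) v, phi (c *: v) = c *: phi v,
      forall v, phi (e1 v) = e2 (phi v),
      forall v, phi (f1 v) = f2 (phi v)
    & forall v, phi (h1 v) = h2 (phi v)].

Definition hom_dim_le e1 f1 h1 e2 f2 h2 (N : nat) : Prop :=
  forall (k : nat) (phis : 'I_k -> V1 -> V2),
    (forall i, is_sl2_hom e1 f1 h1 e2 f2 h2 (phis i)) ->
    (forall c : 'I_k -> C,
        (forall v, \sum_(i < k) c i *: phis i v = 0) -> forall i, c i = 0) ->
    (k <= N)%N.
End Hom.

(* Main.v *)
(* Every rational module is a finite-dimensional vector space over the field
   [K = C(z)]; on it [e] is semilinear for the shift [sigma : z |-> z + 1], while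
   homomorphisms are [K]-linear.  If [e] killed a vector of a rational module, the
   kernels of the powers of [e] would increase up to some stage, contradicting
   [e^(n+1) f - f e^(n+1) = (n+1) (h - n) e^n] and the invertibility of [h - n]; so
   [e] acts on every subquotient by an invertible matrix [E].  An endomorphism with
   matrix [A] satisfies [A^sigma E = E A], hence its characteristic polynomial is
   fixed by [sigma] and has coefficients in [K^sigma = C], hence a root in [C].
   This gives Schur's lemma for simple subquotients.  Refining [Hom (W1, W2)] by two
   chains of maximal length [n1] and [n2] yields a filtration with [n1 * n2] steps,
   each of dimension at most [1]. *)
Require Import Defs.
From HB Require Import structures.
From mathcomp Require Import all_boot all_order all_algebra.
From mathcomp Require Import complex.
From mathcomp Require Import boolp classical_sets reals.
From mathcomp Require Import zify.
Import Order.TTheory GRing.Theory Num.Theory.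
Local Open Scope ring_scope.
Local Open Scope complex_scope.
Set Implicit Arguments. Unset Strict Implicit. Unset Printing Implicit Defensive.
Local Notation "x %:F" := (tofrac x).

(** * Fractions over an integral domain *)

Section FractionField.
Variable D : idomainType.

Lemma fraction_repr (x : {fraction D}) : x = (\n_(repr x))%:F / (\d_(repr x))%:F.
Proof.
have d0 := denom_ratioP (repr x).
have dF0 : (\d_(repr x))%:F != 0 by rewrite tofrac_eq0.
apply: (mulIf dF0); rewrite mulfVK // -{1}[x]reprK.
unlock tofrac; rewrite -[LHS]FracField.pi_mul; apply/eqP.
by rewrite FracField.equivf_def /FracField.mulf !numden_Ratio ?mulr1 ?oner_neq0 // mulrC.
Qed.

Lemma fraction_ex (x : {fraction D}) : exists a b : D, b != 0 /\ x = a%:F / b%:F.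
Proof.
by exists (\n_(repr x)), (\d_(repr x)); split; [exact: denom_ratioP | exact: fraction_repr].
Qed.

Lemma fraction_eq (a b c d : D) : b != 0 -> d != 0 ->
  (a%:F / b%:F == c%:F / d%:F) = (a * d == c * b).
Proof. by move=> b0 d0; rewrite eqr_div ?tofrac_eq0 // -!tofracM tofrac_eq. Qed.

Lemma fraction_sub (a b c d : D) : b != 0 -> d != 0 ->
  a%:F / b%:F - c%:F / d%:F = (a * d - c * b)%:F / (b * d)%:F.
Proof.
move=> b0 d0.
have bF : b%:F != 0 by rewrite tofrac_eq0.
have dF : d%:F != 0 by rewrite tofrac_eq0.
by rewrite tofracB !tofracM -mulNr (addf_div _ _ bF dF) mulNr.
Qed.

End FractionField.

(** * The shift automorphism of [C(z)] and its fixed field *)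

Section Shift.
Variable C : numClosedFieldType.
Local Notation K := {fraction {poly C}}.

Definition pshift (p : {poly C}) : {poly C} := p \Po ('X + 1%:P).

Lemma pshiftK p : pshift p \Po ('X - 1%:P) = p.
Proof.
by rewrite /pshift -comp_polyA comp_polyD comp_polyX comp_polyC subrK comp_polyXr.
Qed.

Lemma pshift_surj p : pshift (p \Po ('X - 1%:P)) = p.
Proof.
by rewrite /pshift -comp_polyA comp_polyB comp_polyX comp_polyC addrK comp_polyXr.
Qed.

Lemma pshift_eq0 p : (pshift p == 0) = (p == 0).
Proof.
apply/eqP/eqP=> [p0|->]; last exact: comp_poly0.
by rewrite -[p]pshiftK p0 comp_poly0.
Qed.

Definition kshift (x : K) : K :=
  locked ((pshift \n_(repr x))%:F / (pshift \d_(repr x))%:F).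

(** Independence of the chosen fraction: composition with ['X + 1] is multiplicative, so it
    preserves the cross-multiplied equality. *)
Lemma kshiftE x a b : b != 0 -> x = a%:F / b%:F ->
  kshift x = (pshift a)%:F / (pshift b)%:F.
Proof.
move=> b0 xE; rewrite /kshift -lock.
have d0 := denom_ratioP (repr x).
have /eqP := etrans (esym xE) (fraction_repr x); rewrite fraction_eq // => /eqP E.
apply/eqP; rewrite fraction_eq ?pshift_eq0 //.
by rewrite -!comp_polyM E.
Qed.

Lemma kshift_is_zmod_morphism : zmod_morphism kshift.
Proof.
move=> x y; have [a [b [b0 xE]]] := fraction_ex x; have [c [d [d0 yE]]] := fraction_ex y.
have xyE : x - y = (a * d - c * b)%:F / (b * d)%:F by rewrite xE yE fraction_sub.
apply: (etrans (kshiftE (mulf_neq0 b0 d0) xyE)).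
apply: (etrans _ (esym (congr2 (fun u v => u - v) (kshiftE b0 xE) (kshiftE d0 yE)))).
rewrite fraction_sub ?pshift_eq0 //.
by rewrite /pshift comp_polyB !comp_polyM.
Qed.

Lemma kshift_is_monoid_morphism : monoid_morphism kshift.
Proof.
split.
  have oneE : 1 = 1%:F / 1%:F :> K by rewrite tofrac1 divr1.
  apply: (etrans (kshiftE (oner_neq0 _) oneE)).
  by rewrite /pshift -polyC1 comp_polyC polyC1 tofrac1 divr1.
move=> x y; have [a [b [b0 xE]]] := fraction_ex x; have [c [d [d0 yE]]] := fraction_ex y.
have xyE : x * y = (a * c)%:F / (b * d)%:F by rewrite xE yE mulf_div -!tofracM.
apply: (etrans (kshiftE (mulf_neq0 b0 d0) xyE)).
apply: (etrans _ (esym (congr2 (fun u v => u * v) (kshiftE b0 xE) (kshiftE d0 yE)))).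
by rewrite mulf_div -!tofracM /pshift !comp_polyM.
Qed.

HB.instance Definition _ := GRing.isZmodMorphism.Build K K kshift
  kshift_is_zmod_morphism.
HB.instance Definition _ := GRing.isMonoidMorphism.Build K K kshift
  kshift_is_monoid_morphism.

Lemma kshift_surj x : exists y, kshift y = x.
Proof.
have [a [b [b0 xE]]] := fraction_ex x.
exists ((a \Po ('X - 1%:P))%:F / (b \Po ('X - 1%:P))%:F).
by rewrite (kshiftE _ erefl) ?pshift_surj // -pshift_eq0 pshift_surj.
Qed.

Definition constK (c : C) : K := (c%:P)%:F.
HB.instance Definition _ := GRing.RMorphism.copy constK (@tofrac {poly C} \o polyC).

(* A shift-invariant ratio [a / b] takes the same value at all large integers,
   so [a - c b] has infinitely many roots. *)
Lemma kshift_fixed (x : K) : kshift x = x -> exists c, x = constK c.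
Proof.
have [a [b [b0 xE]]] := fraction_ex x.
rewrite (kshiftE b0 xE) xE => /eqP; rewrite fraction_eq ?pshift_eq0 // => /eqP E.
pose r n := n%:R : C.
have r_inj : injective r by move=> m n /eqP; rewrite eqr_nat => /eqP.
(* Otherwise [b] would vanish at [size b] distinct integers, too many for a nonzero polynomial. *)
have [N HN] : exists N, forall n, (N <= n)%N -> b.[r n] != 0.
  apply: contrapT => H.
  have H' N : exists n, (N <= n)%N && (b.[r n] == 0).
    apply: contrapT => H1; apply: H; exists N => n Nn; apply/negP=> bn.
    by apply: H1; exists n; rewrite Nn.
  have : forall m, exists2 s : seq nat, size s = m & uniq s && all (fun n => b.[r n] == 0) s.
    elim=> [|m [s <- /andP[us rs]]]; first by exists [::].
    have [n /andP[Nn bn]] := H' (\max_(i <- s) i).+1.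
    exists (n :: s) => //=; rewrite us rs bn !andbT; apply/negP=> ns.
    by move: Nn; rewrite ltnNge (leq_bigmax_seq _ ns).
  move/(_ (size b)) => [s ss /andP[us rs]].
  have := @max_poly_roots _ b (map r s) b0; rewrite map_inj_uniq // us size_map ss ltnn.
  by move=> /(_ _ isT) F; have := F _; rewrite all_map => /(_ rs).
pose c := a.[r N] / b.[r N]; exists c.
(* Evaluating [E] at an integer carries the ratio over to the next one, as [b] does not vanish from
   [N] on. *)
have Hs n : a.[r (N + n)%N] = c * b.[r (N + n)%N].
  elim: n => [|n IH]; first by rewrite addn0 /c mulfVK // HN.
  have := congr1 (fun p => p.[r (N + n)%N]) E.
  rewrite !hornerM /pshift !horner_comp !hornerD !hornerX hornerC.
  have -> : r (N + n)%N + 1 = r (N + n.+1)%N by rewrite /r addnS natr1.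
  rewrite IH => E'; apply: (mulIf (HN (N + n)%N (leq_addr _ _))).
  by rewrite E' mulrAC mulrC mulrA.
suff -> : a = c *: b.
  by rewrite -mul_polyC tofracM mulfK // tofrac_eq0.
apply/eqP; rewrite -subr_eq0; apply/negPn/negP=> p0.
have := max_poly_roots p0 (rs := [seq r (N + n)%N | n <- iota 0 (size (a - c *: b))]).
rewrite size_map size_iota ltnn => F; have /F F' : all (root (a - c *: b))
    [seq r (N + n)%N | n <- iota 0 (size (a - c *: b))].
  apply/allP=> _ /mapP[n _ ->]; rewrite /root hornerD hornerN hornerZ Hs subrr.
  exact: eqxx.
suff /F' : uniq [seq r (N + n)%N | n <- iota 0 (size (a - c *: b))] by [].
by rewrite map_inj_uniq ?iota_uniq // => m n /r_inj /addnI.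
Qed.

End Shift.

(** * Polynomials in [L_0] acting on a module *)

Section Module.
Variables (C : numClosedFieldType) (V : lmodType C) (h : {linear V -> V}).
Local Notation K := {fraction {poly C}}.

Lemma L0D u v : L0 h (u + v) = L0 h u + L0 h v.
Proof. by rewrite /L0 linearD scalerDr opprD. Qed.

Lemma L0Z c v : L0 h (c *: v) = c *: L0 h v.
Proof. by rewrite /L0 (linearZ_LR h) scalerN !scalerA [c * _]mulrC. Qed.

Lemma pact_wide n (p : {poly C}) v : (size p <= n)%N ->
  pact h p v = \sum_(i < n) p`_i *: iter i (L0 h) v.
Proof.
move=> pn; rewrite /pact (big_ord_widen n (fun i => p`_i *: iter i (L0 h) v)) //.
rewrite big_mkcond; apply: eq_bigr => i _; case: ltnP => // ip.
by rewrite nth_default // scale0r.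
Qed.

Lemma pactDr p u v : pact h p (u + v) = pact h p u + pact h p v.
Proof.
rewrite /pact -big_split; apply: eq_bigr => i _ /=; rewrite -scalerDr; congr (_ *: _).
by elim: (i : nat) => //= n ->; rewrite L0D.
Qed.

Lemma pactZr p c v : pact h p (c *: v) = c *: pact h p v.
Proof.
rewrite /pact scaler_sumr; apply: eq_bigr => i _ /=; rewrite scalerA mulrC -scalerA.
by congr (_ *: _); elim: (i : nat) => //= n ->; rewrite L0Z.
Qed.

Lemma pact0r p : pact h p 0 = 0.
Proof. by rewrite -[X in pact h p X](scale0r 0) pactZr scale0r. Qed.

Lemma pactDl p q v : pact h (p + q) v = pact h p v + pact h q v.
Proof.
pose n := maxn (size p) (size q).
rewrite !(@pact_wide n) ?leq_maxl ?leq_maxr ?(leq_trans (size_polyD _ _)) //.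
by rewrite -big_split; apply: eq_bigr => i _ /=; rewrite coefD scalerDl.
Qed.

(** Horner's rule, which drives the inductions on polynomials. *)
Lemma pact_rec p c v : pact h (p * 'X + c%:P) v = pact h p (L0 h v) + c *: v.
Proof.
have s : (size (p * 'X + c%:P)%R <= (size p).+1)%N.
  by rewrite size_MXaddC; case: ifP.
rewrite (pact_wide _ s) big_ord_recl addrC; congr (_ + _).
  by rewrite /pact; apply: eq_bigr => i _; rewrite coefD coefMX coefC /= addr0 -iterSr.
by rewrite coefD coefMX coefC /= add0r.
Qed.

Lemma pactC c v : pact h c%:P v = c *: v.
Proof. by rewrite (@pact_wide 1) ?size_polyC_leq1 // big_ord1 coefC. Qed.

Lemma pactX v : pact h 'X v = L0 h v.
Proof.
by have := pact_rec 1 0 v; rewrite polyC0 addr0 mul1r scale0r addr0 -polyC1 pactC scale1r.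
Qed.

Lemma L0_pact p v : L0 h (pact h p v) = pact h p (L0 h v).
Proof.
elim/poly_ind: p v => [|p c IH] v; last by rewrite !pact_rec L0D L0Z IH.
by rewrite -polyC0 !pactC L0Z !scale0r.
Qed.

Lemma pactM p q v : pact h (p * q) v = pact h p (pact h q v).
Proof.
elim/poly_ind: p q v => [|p c IH] q v.
  by rewrite mul0r -polyC0 !pactC !scale0r.
rewrite mulrDl pactDl pact_rec -(mulrA p 'X q). rewrite IH ['X * q]mulrC; congr (_ + _).
  by have := pact_rec q 0 v; rewrite polyC0 addr0 scale0r addr0 L0_pact => ->.
elim/poly_ind: q v {IH} => [|q d IH] v.
  by rewrite mulr0 -polyC0 !pactC !scale0r scaler0.
by rewrite mulrDr mulrA -polyCM !pact_rec IH scalerDr scalerA.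
Qed.

End Module.

(** * Linear algebra over [C(z)], modulo a subspace *)

Section FractionAction.
Variables (C : numClosedFieldType) (V : lmodType C) (h : {linear V -> V}).
Local Notation K := {fraction {poly C}}.

(* For [x = n / d], the [w] with [d(L_0) w = n(L_0) v]; the default value [0] is
   never taken when nonzero polynomials in [L_0] are bijective. *)
Definition kact (x : K) (v : V) : V :=
  xget 0 [set w | pact h \d_(repr x) w = pact h \n_(repr x) v].

Hypothesis pact_bij : forall p : {poly C}, p != 0 -> bijective (pact h p).

Lemma pact_inj p u v : p != 0 -> pact h p u = pact h p v -> u = v.
Proof. by move=> /pact_bij/bij_inj; apply. Qed.

Lemma kactP x a b v : b != 0 -> x = a%:F / b%:F ->
  pact h b (kact x v) = pact h a v.
Proof.
move=> b0 xE; have d0 := denom_ratioP (repr x).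
have /eqP := etrans (esym xE) (fraction_repr x); rewrite fraction_eq // => /eqP E.
have Ex : pact h \d_(repr x) (kact x v) = pact h \n_(repr x) v.
  have [g _ gK] := pact_bij d0.
  exact: (@xgetPex _ 0 [set w | pact h \d_(repr x) w = pact h \n_(repr x) v]
    (ex_intro _ (g _) (gK _))).
apply: (pact_inj d0); rewrite -pactM [_ * b]mulrC pactM Ex -!pactM.
by rewrite [b * _]mulrC -E [a * _]mulrC.
Qed.

(** Reduces identities for fractions to polynomial ones: apply a denominator to both sides, then
    cancel it by injectivity. *)
Lemma kact_uniq x a b v w : b != 0 -> x = a%:F / b%:F ->
  pact h b w = pact h a v -> kact x v = w.
Proof. by move=> b0 xE bw; apply: (pact_inj b0); rewrite (kactP _ b0 xE). Qed.

Lemma kactDr x u v : kact x (u + v) = kact x u + kact x v.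
Proof.
have [a [b [b0 xE]]] := fraction_ex x; apply: (kact_uniq b0 xE).
by rewrite !pactDr !(kactP _ b0 xE).
Qed.

Lemma kactA x y v : kact x (kact y v) = kact (x * y) v.
Proof.
have [a [b [b0 xE]]] := fraction_ex x; have [c [d [d0 yE]]] := fraction_ex y.
have xyE : x * y = (a * c)%:F / (b * d)%:F by rewrite xE yE mulf_div -!tofracM.
apply: esym; apply: (kact_uniq (mulf_neq0 b0 d0) xyE).
by rewrite mulrC pactM (kactP _ b0 xE) -pactM mulrC pactM (kactP _ d0 yE) pactM.
Qed.

Lemma kactDl x y v : kact (x + y) v = kact x v + kact y v.
Proof.
have [a [b [b0 xE]]] := fraction_ex x; have [c [d [d0 yE]]] := fraction_ex y.
have xyE : x + y = (a * d + c * b)%:F / (b * d)%:F.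
  have bF : b%:F != 0 :> K by rewrite tofrac_eq0.
  have dF : d%:F != 0 :> K by rewrite tofrac_eq0.
  by rewrite xE yE tofracD !tofracM (addf_div _ _ bF dF).
apply: (kact_uniq (mulf_neq0 b0 d0) xyE).
rewrite pactDr pactDl [in X in X + _]mulrC !pactM (kactP _ b0 xE) (kactP _ d0 yE).
by rewrite -!pactM [d * a]mulrC [c * b]mulrC.
Qed.

Lemma kact_tofrac p v : kact p%:F v = pact h p v.
Proof.
have pE : p%:F = p%:F / 1%:F :> K by rewrite tofrac1 divr1.
by apply: (kact_uniq (oner_neq0 _) pE); rewrite -polyC1 pactC scale1r.
Qed.

Lemma kact_const c v : kact (constK c) v = c *: v.
Proof. by rewrite /constK kact_tofrac pactC. Qed.

Lemma kact1 v : kact 1 v = v.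
Proof. by rewrite -tofrac1 kact_tofrac -polyC1 pactC scale1r. Qed.

Lemma kact0l v : kact 0 v = 0.
Proof. by apply: (addrI (kact 0 v)); rewrite -kactDl !addr0. Qed.

Lemma kact0r x : kact x 0 = 0.
Proof. by apply: (addrI (kact x 0)); rewrite -kactDr !addr0. Qed.

Lemma kact_sumr I (r : seq I) (F : I -> V) x :
  kact x (\sum_(i <- r) F i) = \sum_(i <- r) kact x (F i).
Proof. exact: (big_morph (kact x) (kactDr x) (kact0r x)). Qed.

Lemma kact_N1 v : kact (-1) v = - v.
Proof. by apply: (addrI v); rewrite -{1}[v]kact1 -kactDl !subrr kact0l. Qed.

Lemma kactBr x u v : kact x (u - v) = kact x u - kact x v.
Proof. by rewrite -!kact_N1 kactDr !kactA mulN1r mulrN1. Qed.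

Definition ksub (S : V -> Prop) : Prop :=
  [/\ S 0, forall u v, S u -> S v -> S (u + v) & forall x v, S v -> S (kact x v)].

Lemma ksubB S u v : ksub S -> S u -> S v -> S (u - v).
Proof. by move=> [_ SD SZ] Su Sv; apply: (SD _ _ Su); rewrite -kact_N1; apply: SZ. Qed.

Lemma ksub_sum S I (r : seq I) (P : pred I) (F : I -> V) : ksub S ->
  (forall i, P i -> S (F i)) -> S (\sum_(i <- r | P i) F i).
Proof. by move=> [S0 SD _] SF; elim/big_ind: _. Qed.

Lemma ksub_kact_inv S x v : ksub S -> x != 0 -> S (kact x v) -> S v.
Proof. by move=> [_ _ SZ] x0 /(SZ x^-1); rewrite kactA mulVf // kact1. Qed.

(** The family is indexed by [nat], so that it can be extended without changing its type. *)
Definition lin m (b : nat -> V) (x : 'rV[K]_m) : V := \sum_(i < m) kact (x 0 i) (b i).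

Lemma linD m (b : nat -> V) (x y : 'rV[K]_m) : lin b (x + y) = lin b x + lin b y.
Proof. by rewrite /lin -big_split; apply: eq_bigr => i _; rewrite mxE kactDl. Qed.

Lemma linZ m (b : nat -> V) c (x : 'rV[K]_m) : lin b (c *: x) = kact c (lin b x).
Proof. by rewrite /lin kact_sumr; apply: eq_bigr => i _; rewrite mxE kactA. Qed.

Lemma linB m (b : nat -> V) (x y : 'rV[K]_m) : lin b (x - y) = lin b x - lin b y.
Proof. by rewrite linD -(scaleN1r y) linZ kact_N1. Qed.

Lemma lin0 m (b : nat -> V) : lin b (0 : 'rV[K]_m) = 0.
Proof. by have := linZ b 0 (0 : 'rV_m); rewrite scale0r kact0l. Qed.

Lemma lin_sum m (b : nat -> V) I (r : seq I) (F : I -> 'rV[K]_m) :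
  lin b (\sum_(i <- r) F i) = \sum_(i <- r) lin b (F i).
Proof. exact: (big_morph (@lin m b) (@linD m b) (@lin0 m b)). Qed.

Lemma lin_mul m n (b : nat -> V) (x : 'rV[K]_m) (A : 'M[K]_(m, n)) :
  lin b (x *m A) = \sum_(i < m) kact (x 0 i) (lin b (row i A)).
Proof. by rewrite mulmx_sum_row lin_sum; apply: eq_bigr => i _; rewrite linZ. Qed.

Lemma ksub_lin S m (b : nat -> V) (x : 'rV[K]_m) : ksub S ->
  (forall i, (i < m)%N -> S (b i)) -> S (lin b x).
Proof. by move=> kS Sb; apply: ksub_sum => // i _; case: kS => _ _; apply; apply: Sb. Qed.

Definition indep (S : V -> Prop) m (b : nat -> V) : Prop :=
  forall x : 'rV[K]_m, S (lin b x) -> x = 0.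

Lemma indep_extend S m b v : ksub S -> indep S m b ->
  ~ (exists x : 'rV[K]_m, S (v - lin b x)) ->
  indep S m.+1 (fun i => if (i < m)%N then b i else v).
Proof.
move=> kS ib nv x; pose y := \row_(i < m) x 0 (widen_ord (leqnSn m) i).
have -> : lin (fun i => if (i < m)%N then b i else v) x = lin b y + kact (x 0 ord_max) v.
  rewrite /lin big_ord_recr /= ltnn; congr (_ + _).
  by apply: eq_bigr => i _; rewrite mxE ltn_ord.
have [x0|x0] := eqVneq (x 0 ord_max) 0.
  rewrite x0 kact0l addr0 => /ib y0; apply/rowP => i; rewrite mxE.
  case: (unliftP ord_max i) => [j ->|-> //].
  move/rowP/(_ j): y0; rewrite !mxE => <-; congr (x 0 _).
  by apply: val_inj; rewrite /= /bump leqNgt ltn_ord.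
(* The relation is solved for [v] by dividing by its nonzero last coefficient. *)
move=> Sx; case: nv; exists (- (x 0 ord_max)^-1 *: y).
apply: (ksub_kact_inv kS x0); rewrite linZ -kact_N1 kactDr !kactA.
by rewrite mulrN1 mulrNN mulfV // kact1 addrC.
Qed.

Variable s : seq V.
Hypothesis s_span : forall v, exists x : 'rV[K]_(size s), v = lin (nth 0 s) x.

(** With more than [size s] vectors the coordinate matrix has a nonzero left kernel; its rows are
    relations with value [0], which lies in [S]. *)
Lemma indep_le S m b : ksub S -> indep S m b -> (m <= size s)%N.
Proof.
move=> [S0 _ _] ib; rewrite leqNgt; apply/negP=> lt_sm.
have [A AE] := fin_all_exists (fun i : 'I_m => s_span (b i)).
pose M := \matrix_(i < m) A i.
have : kermx M != 0.
  by rewrite kermx_eq0 /row_free neq_ltn (leq_ltn_trans (rank_leq_col _)).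
case/eqP; apply/row_matrixP => i; rewrite row0; apply: ib.
have -> : lin b (row i (kermx M)) = lin (nth 0 s) (row i (kermx M) *m M).
  by rewrite lin_mul /lin; apply: eq_bigr => j _; rewrite rowK AE.
by rewrite -row_mul mulmx_ker row0 lin0.
Qed.

(** One vector chosen in each gap of the chain gives a linearly independent family. *)
Lemma ksub_chain_le (S : nat -> V -> Prop) m :
  (forall i, (i <= m)%N -> ksub (S i)) ->
  (forall i, (i < m)%N -> (forall v, S i v -> S i.+1 v) /\ exists v, S i.+1 v /\ ~ S i v) ->
  (m <= size s)%N.
Proof.
move=> kS S_inc; pose Z v := v = 0 :> V.
have kZ : ksub Z.
  by split=> // [u v -> ->|x v ->]; rewrite /Z ?addr0 ?kact0r.
suff : exists b, indep Z m b /\ forall i, (i < m)%N -> S m (b i).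
  by move=> [b [ib _]]; exact: indep_le kZ ib.
have H : forall i, (i <= m)%N -> exists b, indep Z i b /\ forall j, (j < i)%N -> S i (b j).
  elim=> [_|i IH im]; first by exists (fun=> 0); split=> // x _; apply/rowP; case.
  have [b [ib Sb]] := IH (ltnW im); have [Sii [v [Sv nSv]]] := S_inc i im.
  exists (fun j => if (j < i)%N then b j else v); split; last first.
    by move=> j _; case: ifP => // /Sb/Sii.
  apply: indep_extend => // -[x /subr0_eq vE].
  by apply: nSv; rewrite vE; apply: ksub_lin => //; exact/kS/ltnW.
exact: H.
Qed.

End FractionAction.

(** * The operators [e], [f], [h] on a rational module *)

Section RationalModule.
Variables (C : numClosedFieldType) (V : lmodType C) (e f h : {linear V -> V}).
Local Notation K := {fraction {poly C}}.
Hypothesis sl2_act : is_sl2_action e f h.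
Hypothesis rat_h : is_rational h.
Let pact_bij := proj1 rat_h.

Lemma e_L0 v : e (L0 h v) = L0 h (e v) + e v.
Proof.
have [_ he _] := sl2_act; rewrite /L0 (linearN e) (linearZ_LR e).
have -> : e (h v) = h (e v) - 2%:R *: e v by rewrite -he opprB addrC subrK.
by rewrite scalerBr opprB scalerA mulVf ?pnatr_eq0 // scale1r addrC.
Qed.

(** Source of the shift: [e L_0 = (L_0 + 1) e]. *)
Lemma e_pact p v : e (pact h p v) = pact h (pshift p) (e v).
Proof.
elim/poly_ind: p v => [|p c IH] v.
  by rewrite /pshift comp_poly0 -polyC0 !pactC !scale0r (linear0 e).
rewrite pact_rec (linearD e) (linearZ_LR e) IH e_L0 /pshift comp_poly_MXaddC.
by rewrite pactDl pactC pactM [pact h (_ + _) _]pactDl pactX pactC scale1r.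
Qed.

Lemma e_kact x v : e (kact h x v) = kact h (kshift x) (e v).
Proof.
have [a [b [b0 xE]]] := fraction_ex x; apply: esym.
have sb0 : pshift b != 0 by rewrite pshift_eq0.
apply: (kact_uniq pact_bij sb0 (kshiftE b0 xE)).
by rewrite -!e_pact (kactP pact_bij _ b0 xE).
Qed.

(** Since [h = -2 z], the operator [h - n] is a nonzero scalar of [K]: it preserves subspaces and
    can be inverted on them. *)
Lemma h_subE n v : h v - n%:R *: v = kact h ((-2%:R)%:P * 'X - n%:R%:P)%:F v.
Proof.
rewrite (kact_tofrac pact_bij) pactDl pactM pactC pactX -polyCN pactC scaleNr.
by rewrite /L0 scalerN scaleNr opprK scalerA mulfV ?pnatr_eq0 // scale1r.
Qed.

Lemma rational_span : exists s : seq V,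
  forall v, exists x : 'rV[K]_(size s), v = lin h (nth 0 s) x.
Proof.
have [_ [s Hs]] := rat_h; exists s => v; have [q [ps [q0 E]]] := Hs v.
exists (\row_j ((ps j)%:F / q%:F)); apply: (pact_inj pact_bij q0); rewrite E.
rewrite -(kact_tofrac pact_bij) /lin (kact_sumr pact_bij); apply: eq_bigr => j _.
by rewrite mxE (kactA pact_bij) mulrC mulfVK ?tofrac_eq0 // (kact_tofrac pact_bij).
Qed.

(** Saturation under nonzero polynomials turns polynomial stability into stability under fractions;
    conversely, [h] acts as a scalar of [K]. *)
Lemma rational_submoduleE S : is_rational_submodule e f h S <->
  ksub h S /\ forall v, S v -> S (e v) /\ S (f v).
Proof.
split=> [[S0 SD SZ Sefh Ssat]|[kS Sef]].
  split; last by move=> v /Sefh[? []].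
  split=> // x v Sv; have [a [b [b0 xE]]] := fraction_ex x.
  apply: (Ssat b) => //; rewrite (kactP pact_bij _ b0 xE).
  elim/poly_ind: a v Sv {xE} => [|p c IH] v Sv; first by rewrite -polyC0 pactC scale0r.
  rewrite pact_rec; apply: SD; last exact: SZ.
  apply: IH; rewrite /L0 -scaleNr; apply: SZ.
  by have [? []] := Sefh _ Sv.
have [S0 SD SZ] := kS; split=> // [c v Sv|v Sv|p v p0].
- by rewrite -(kact_const pact_bij); apply: SZ.
- by have [? ?] := Sef _ Sv; do ! split=> //; rewrite -[h v]subr0 -(scale0r v) (h_subE 0); apply: SZ.
- rewrite -(kact_tofrac pact_bij); apply: (ksub_kact_inv pact_bij kS).
  by rewrite tofrac_eq0.
Qed.

Lemma iter_eD n u v : iter n e (u + v) = iter n e u + iter n e v.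
Proof. by elim: n => //= n ->; rewrite (linearD e). Qed.

Lemma iter_e_kact n x v : exists y, iter n e (kact h x v) = kact h y (iter n e v).
Proof.
elim: n => [|n [y IH]]; first by exists x.
by exists (kshift y); rewrite /= IH e_kact.
Qed.

Lemma iter_e_f n v : iter n.+1 e (f v) =
  f (iter n.+1 e v) + n.+1%:R *: (h (iter n e v) - n%:R *: iter n e v).
Proof.
have [ef he _] := sl2_act.
elim: n => [|n IH]; first by rewrite /= scale0r subr0 scale1r -ef addrC subrK.
rewrite iterS IH (linearD e) -[LHS]/(e (f (iter n.+1 e v)) + _).
rewrite -[e (f _)](subrK (f (e (iter n.+1 e v)))) ef.
rewrite (linearZ_LR e) (linearB e) (linearZ_LR e).
have eh u : e (h u) = h (e u) - 2%:R *: e u by rewrite -he opprB addrC subrK.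
rewrite eh -[e (iter n e v)]/(iter n.+1 e v) -/(iter n.+2 e v).
set w := iter n.+1 e v; rewrite addrAC addrC; congr (_ + _).
(* What remains is [h + (n+1)(h - (n+2)) = (n+2)(h - (n+1))], applied to [w]. *)
rewrite -[_ - _ - n%:R *: w]addrA -opprD -scalerDl -natrD !scalerBr !scalerA addrA.
rewrite -{1}[h w]scale1r -scalerDl -!natrM nat1r.
by congr (_ - _%:R *: _); lia.
Qed.

(* The increasing chain [K_n = {v | e^n v \in S}] is stationary by dimension;
   [e, f]-commutation moves the stationarity index down to [0]. *)
Lemma e_inj_mod S v : is_rational_submodule e f h S -> S (e v) -> S v.
Proof.
move=> /rational_submoduleE[kS Sef]; have [S0 SD SZ] := kS.
have [s s_span] := rational_span.
have kK n : ksub h (fun v => S (iter n e v)).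
  split=> [|u w Su Sw|x w Sw].
  - by elim: n => //= n /Sef[].
  - by rewrite iter_eD; apply: SD.
  - by have [y ->] := iter_e_kact n x w; apply: SZ.
have KS n w : S (iter n e w) -> S (iter n.+1 e w) by move=> /Sef[].
have [N HN] : exists N, forall w, S (iter N.+1 e w) -> S (iter N e w).
  apply: contrapT => H.
  suff : ((size s).+1 <= size s)%N by rewrite ltnn.
  apply: (ksub_chain_le pact_bij s_span (S := fun n w => S (iter n e w))) => // n _.
  split=> [w|]; first exact: KS.
  apply: contrapT => H1; apply: H; exists n => w Sw; apply: contrapT => nSw.
  by apply: H1; exists w.
elim: N HN v => [|N IH] HN v; first exact: HN v.
apply: IH => {}v Sv.
(* For [e^(N+1) v] in [S], both terms of [e^(N+2) f v] lie in [S], so [HN] applies to [f v].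
   Expanding [e^(N+1) f v] then leaves [(N+1)(h - N) e^N v] in [S]. *)
have Sfv : S (iter N.+1 e (f v)).
  apply: HN; rewrite iter_e_f; apply: SD; first by have [] := Sef _ (proj1 (Sef _ Sv)).
  rewrite -(kact_const pact_bij) h_subE; apply/SZ/SZ; exact: Sv.
have := ksubB pact_bij kS Sfv (proj2 (Sef _ Sv)).
rewrite iter_e_f addrAC subrr add0r -(kact_const pact_bij) h_subE.
move=> /(ksub_kact_inv pact_bij kS) H1; have /H1 : constK N.+1%:R != 0 :> K.
  by rewrite /constK tofrac_eq0 polyC_eq0 pnatr_eq0.
apply: (ksub_kact_inv pact_bij kS); rewrite tofrac_eq0.
(* The scalar is nonzero because its coefficient of ['X] is [-2]. *)
apply/eqP => /(congr1 (fun p : {poly C} => p`_1)); rewrite coefB coefCM coefX coefC coef0 /=.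
by move/eqP; rewrite mulr1 subr0 oppr_eq0 pnatr_eq0.
Qed.

End RationalModule.

(** * Length, simple steps and bases of subquotients *)

Lemma ex_max_nat (P : nat -> Prop) N : (exists n, P n) ->
  (forall n, P n -> (n <= N)%N) -> exists n, P n /\ forall m, P m -> (m <= n)%N.
Proof.
move=> [n0 Pn0] PN.
have exP : exists n, `[< P n >] by exists n0; apply/asboolP.
have ubP n : `[< P n >] -> (n <= N)%N by move/asboolP/PN.
case: (ex_maxnP exP ubP) => n /asboolP Pn nmax.
by exists n; split=> // m Pm; apply: nmax; apply/asboolP.
Qed.

Section Length.
Variables (C : numClosedFieldType) (V : lmodType C) (e f h : {linear V -> V}).
Local Notation K := {fraction {poly C}}.

(** The quotient [S' / S] has no proper nonzero rational submodule; [S = S'] is allowed. *)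
Definition simple_step (S S' : V -> Prop) : Prop :=
  [/\ is_rational_submodule e f h S, is_rational_submodule e f h S',
      forall v, S v -> S' v
    & forall X, is_rational_submodule e f h X -> (forall v, S v -> X v) ->
        (forall v, X v -> S' v) -> (forall v, X v -> S v) \/ (forall v, S' v -> X v)].

Lemma max_chain_simple n S i : is_length e f h n -> rational_chain e f h n S ->
  (i < n)%N -> simple_step (S i) (S i.+1).
Proof.
move=> [_ nmax] [subS S0 Sn S_inc] lt_in; have [Si _] := S_inc i lt_in.
split=> // [||X subX SX XS]; [exact/subS/ltnW | exact: subS |].
have [H|/existsNP[v /not_implyP[Xv nSv]]] := pselect (forall v, X v -> S i v); first by left.
have [H|/existsNP[w /not_implyP[Sw nXw]]] := pselect (forall v, S i.+1 v -> X v); first by right.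
(* Inserting [X] at index [i.+1] and moving the later terms up by one contradicts maximality. *)
pose T j := if (j <= i)%N then S j else if j == i.+1 then X else S j.-1.
suff : (n.+1 <= n)%N by rewrite ltnn.
apply: nmax; exists T; split=> [j jn||u|j jn].
- rewrite /T; case: ifP => [ji|ji]; first by apply: subS; exact: leq_trans ji (ltnW lt_in).
  by case: ifP => // _; apply: subS; case: j jn {ji}.
- exact: S0.
- rewrite /T ifF ?ifF ?Sn //; lia.
- rewrite /T; have [ji|ij|->] := ltngtP j i.
  + by apply: S_inc; lia.
  + have [->|ji] := eqVneq j i.+1; first by rewrite ifF; [split=> //; exists w|lia].
    rewrite ifF; last lia.
    have -> : j.+1.-1 = j.-1.+1 by lia.
    by apply: S_inc; lia.
  + by rewrite eqxx; split=> //; exists v.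
Qed.

Hypothesis rat_h : is_rational h.

Lemma length_exists : exists n, is_length e f h n.
Proof.
have sub_all : is_rational_submodule e f h (fun=> True) by split.
have sub0 : is_rational_submodule e f h (fun v => v = 0).
  split=> // [u v -> ->|c v ->|v ->|p v p0]; rewrite ?addr0 ?scaler0 ?linear0 //.
  by move=> E; apply: (pact_inj (proj1 rat_h) p0); rewrite E pact0r.
have [s s_span] := rational_span rat_h.
apply: (@ex_max_nat (fun n => exists S, rational_chain e f h n S) (size s)); last first.
  move=> m [S [subS _ _ S_inc]].
  apply: (ksub_chain_le (proj1 rat_h) s_span _ S_inc) => i im.
  by have [] := proj1 (rational_submoduleE _ _ rat_h (S i)) (subS i im).
(* Some chain exists: the one of length 0 if [V = 0], otherwise [0] inside [V]. *)
have [V0|/existsNP[v v0]] := pselect (forall v : V, v = 0).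
  by exists 0%N, (fun _ v => v = 0); split.
exists 1%N, (fun i => if i is 0 then (fun v => v = 0) else fun=> True).
split=> // [[|i] _ //|[|//] _].
by split=> //; exists v.
Qed.

(** A longest family in [S'] independent modulo [S]; a vector outside its span would extend it. *)
Lemma exists_basis_mod S S' : is_rational_submodule e f h S -> is_rational_submodule e f h S' ->
  exists m b, [/\ forall i, (i < m)%N -> S' (b i), indep h S m b
    & forall v, S' v -> exists x : 'rV[K]_m, S (v - lin h b x)].
Proof.
move=> /(rational_submoduleE _ _ rat_h)[kS _] /(rational_submoduleE _ _ rat_h)[kS' _].
have [s s_span] := rational_span rat_h.
pose P m := exists b, (forall i, (i < m)%N -> S' (b i)) /\ indep h S m b.
have [||m [[b [Sb ib]] mmax]] := @ex_max_nat P (size s).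
- by exists 0%N, (fun=> 0); split=> // x _; apply/rowP; case.
- by move=> m [b [_ ib]]; exact: (indep_le (proj1 rat_h) s_span kS ib).
exists m, b; split=> // v Sv; apply: contrapT => nx.
suff /mmax : P m.+1 by rewrite ltnn.
exists (fun i => if (i < m)%N then b i else v); split; last first.
  exact: (indep_extend (proj1 rat_h)).
by move=> i _; case: ifP => // /Sb.
Qed.

End Length.

(** * Homomorphisms, their kernels and images on subquotients *)

Section Hom.
Variables (C : numClosedFieldType).
Variables (V1 : lmodType C) (e1 f1 h1 : {linear V1 -> V1}).
Variables (V2 : lmodType C) (e2 f2 h2 : {linear V2 -> V2}).
Local Notation K := {fraction {poly C}}.
Local Notation is_hom := (is_sl2_hom e1 f1 h1 e2 f2 h2).

Lemma homB phi u v : is_hom phi -> phi (u - v) = phi u - phi v.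
Proof. by move=> [phiD phiZ _ _ _]; rewrite -scaleN1r phiD phiZ scaleN1r. Qed.

Lemma hom0 phi : is_hom phi -> phi 0 = 0.
Proof. by move=> [_ phiZ _ _ _]; rewrite -(scale0r 0) phiZ scale0r. Qed.

Lemma hom_comb phi psi c : is_hom phi -> is_hom psi ->
  is_hom (fun v => psi v - c *: phi v).
Proof.
move=> [aD aZ ae af ah] [bD bZ be bf bh]; split=> [u v|a v|v|v|v].
- by rewrite aD bD scalerDr opprD addrACA.
- by rewrite aZ bZ scalerBr !scalerA mulrC.
- by rewrite ae be linearB (linearZ_LR e2).
- by rewrite af bf linearB (linearZ_LR f2).
- by rewrite ah bh linearB (linearZ_LR h2).
Qed.

Hypothesis rat1 : is_rational h1.
Hypothesis rat2 : is_rational h2.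
Let bij1 := proj1 rat1.
Let bij2 := proj1 rat2.

Lemma hom_pact phi p v : is_hom phi -> phi (pact h1 p v) = pact h2 p (phi v).
Proof.
move=> hphi; have [phiD phiZ _ _ phih] := hphi.
elim/poly_ind: p v => [|p c IH] v; first by rewrite -polyC0 !pactC !scale0r hom0.
by rewrite !pact_rec phiD IH phiZ; congr (pact _ _ _ + _); rewrite /L0 -scaleNr phiZ phih scaleNr.
Qed.

Lemma hom_kact phi x v : is_hom phi -> phi (kact h1 x v) = kact h2 x (phi v).
Proof.
move=> hphi; have [a [b [b0 xE]]] := fraction_ex x; apply: esym.
by apply: (kact_uniq bij2 b0 xE); rewrite -!hom_pact // (kactP bij1 _ b0 xE).
Qed.

(** Represents the kernel of the map that [phi] induces into the quotient by [T]. *)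
Lemma rational_submodule_preimage phi S T : is_hom phi ->
  is_rational_submodule e1 f1 h1 S -> is_rational_submodule e2 f2 h2 T ->
  is_rational_submodule e1 f1 h1 (fun v => S v /\ T (phi v)).
Proof.
move=> hphi [S0 SD SZ Sefh Ss] [T0 TD TZ Tefh Ts]; have [phiD phiZ phie phif phih] := hphi.
split=> [|u v [Su Tu] [Sv Tv]|c v [Sv Tv]|v [Sv Tv]|p v p0 [Sv]].
- by rewrite hom0.
- by rewrite phiD; split; auto.
- by rewrite phiZ; split; auto.
- have [? [? ?]] := Sefh _ Sv; have [? [? ?]] := Tefh _ Tv.
  by rewrite phie phif phih.
- by rewrite hom_pact //; split; [exact: Ss p0 _ | exact: Ts p0 _].
Qed.

(** Represents the image of that induced map: the submodule is [phi(S) + T]. *)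
Lemma rational_submodule_image phi S T : is_hom phi ->
  is_rational_submodule e1 f1 h1 S -> is_rational_submodule e2 f2 h2 T ->
  is_rational_submodule e2 f2 h2 (fun w => exists v, S v /\ T (w - phi v)).
Proof.
move=> hphi /(rational_submoduleE _ _ rat1)[[S0 SD SZ] Sef].
move=> /(rational_submoduleE _ _ rat2)[[T0 TD TZ] Tef]; have [phiD phiZ phie phif _] := hphi.
apply/(rational_submoduleE _ _ rat2); split; last first.
  move=> w [v [/Sef[Sev Sfv] /Tef[]]]; rewrite !linearB -phie -phif => Te Tf.
  by split; [exists (e1 v) | exists (f1 v)].
split=> [|u w [u' [Su Tu]] [w' [Sw Tw]]|x w [v [Sv Tv]]].
- by exists 0; rewrite hom0 // subr0.
- by exists (u' + w'); split; [exact: SD | rewrite phiD opprD addrACA; exact: TD].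
- exists (kact h1 x v); split; first exact: SZ.
  by rewrite hom_kact // -(kactBr bij2); apply: TZ.
Qed.

End Hom.

(** * Eigenvalues in [C] and Schur's lemma *)

Lemma poly_root_exists (C : numClosedFieldType) (F : fieldType)
  (iota : {rmorphism C -> F}) (p : {poly F}) :
  (forall i, exists c, p`_i = iota c) -> size p != 1%N -> exists c, root p (iota c).
Proof.
move=> /choice[g gE] sp.
pose q := \poly_(i < size p) g i.
have pE : p = map_poly iota q.
  apply/polyP => i; rewrite coef_map coef_poly.
  case: ltnP => [_|H]; first exact: gE.
  by rewrite (raddf0 iota) nth_default.
have [c rc] : exists c, root q c.
  by apply/closed_rootP; rewrite -(size_map_poly iota) -pE.
by exists c; rewrite pE fmorph_root.
Qed.

(** Take determinants in [(X - B) E = E (X - A)] and cancel [det E]. *)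
Lemma char_poly_conj (F : fieldType) m (A B E : 'M[F]_m) :
  E \in unitmx -> B *m E = E *m A -> char_poly B = char_poly A.
Proof.
move=> Eu BE; have dE : \det (map_mx polyC E) != 0.
  by rewrite det_map_mx polyC_eq0 -unitfE -unitmxE.
apply: (mulIf dE); rewrite /char_poly -det_mulmx mulrC -det_mulmx; congr (\det _).
by rewrite /char_poly_mx mulmxBl mulmxBr -!map_mxM BE scalar_mxC.
Qed.

Section SimpleSteps.
Variables (C : numClosedFieldType).
Variables (V1 : lmodType C) (e1 f1 h1 : {linear V1 -> V1}).
Variables (V2 : lmodType C) (e2 f2 h2 : {linear V2 -> V2}).
Local Notation K := {fraction {poly C}}.
Local Notation is_hom := (is_sl2_hom e1 f1 h1 e2 f2 h2).
Hypothesis act1 : is_sl2_action e1 f1 h1.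
Hypothesis rat1 : is_rational h1.
Hypothesis rat2 : is_rational h2.
Let bij1 := proj1 rat1.
Let bij2 := proj1 rat2.

Lemma e_lin m (b : nat -> V1) (x : 'rV[K]_m) :
  e1 (lin h1 b x) = \sum_(i < m) kact h1 (kshift (x 0 i)) (e1 (b i)).
Proof. by rewrite /lin linear_sum; apply: eq_bigr => i _; rewrite (e_kact act1 rat1). Qed.

(* Schur's lemma for the simple subquotients [S' / S] and [T' / T].  In a basis
   of [S' / S], let [A] and [E] be the matrices of [phi^-1 psi] and of [e]; as
   [e] is semilinear, [A^sigma E = E A], so the characteristic polynomial of [A]
   is shift-invariant, hence has coefficients, and an eigenvalue, in [C]. *)
Lemma simple_step_schur S S' T T' phi psi :
  simple_step e1 f1 h1 S S' -> simple_step e2 f2 h2 T T' ->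
  is_hom phi -> is_hom psi ->
  (forall v, S v -> T (phi v)) -> (forall v, S v -> T (psi v)) ->
  (forall v, S' v -> T' (phi v)) -> (forall v, S' v -> T' (psi v)) ->
  ~ (forall v, S' v -> T (phi v)) ->
  exists c, forall v, S' v -> T (psi v - c *: phi v).
Proof.
move=> [subS subS' SS' Ssimple] [subT subT' TT' Tsimple] hphi hpsi.
move=> phiS psiS phiS' psiS' nphi.
have [kS _] := proj1 (rational_submoduleE _ _ rat1 S) subS.
have [kS' _] := proj1 (rational_submoduleE _ _ rat1 S') subS'.
have [kT Tef] := proj1 (rational_submoduleE _ _ rat2 T) subT.
have [kT' _] := proj1 (rational_submoduleE _ _ rat2 T') subT'.
have [_ SD SZ] := kS; have [_ TD TZ] := kT.
(* By simplicity the kernel is [S] or [S'], and [nphi] excludes [S']. *)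
have phi_inj v : S' v -> T (phi v) -> S v.
  have := rational_submodule_preimage hphi subS' subT.
  move/Ssimple => []; [by move=> u Su; split; auto|by move=> u []|by move=> H Sv Tv; apply: H|].
  by move=> H; case: nphi => u /H[].
(* By simplicity [phi(S') + T] is [T] or [T'], and [nphi] excludes [T]. *)
have phi_surj w : T' w -> exists v, S' v /\ T (w - phi v).
  have := rational_submodule_image rat1 rat2 hphi subS' subT.
  move/Tsimple => [||H|H]; last exact: H.
  - move=> u Tu; exists 0; rewrite (hom0 hphi) subr0; split=> //; by case: kS'.
  - move=> u [v [/phiS' Tv /TT' Tu]]; rewrite -(subrK (phi v) u).
    by case: kT' => _ TD' _; apply: TD'.
  - case: nphi => v Sv; apply: H; exists v; split=> //; rewrite subrr; by case: kT.
have [m [b [Sb ib b_span]]] := exists_basis_mod rat1 subS subS'.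
have Slin (x : 'rV[K]_m) : S' (lin h1 b x) by apply: ksub_lin.
have /fin_all_exists[A AE] (i : 'I_m) : exists x : 'rV[K]_m, T (psi (b i) - phi (lin h1 b x)).
  have [v [Sv Tv]] := phi_surj _ (psiS' _ (Sb i (ltn_ord i))).
  have [x Sx] := b_span v Sv; exists x.
  have -> : psi (b i) - phi (lin h1 b x) = (psi (b i) - phi v) + phi (v - lin h1 b x).
    by rewrite (homB _ _ hphi) addrA subrK.
  by apply: TD => //; apply: phiS.
pose M := \matrix_(i < m) A i.
have /fin_all_exists[E0 EE] (i : 'I_m) : exists x : 'rV[K]_m, S (e1 (b i) - lin h1 b x).
  apply: b_span.
  by case: subS' => _ _ _ + _ => /(_ _ (Sb i (ltn_ord i)))[].
pose E := \matrix_(i < m) E0 i.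
have psiE (x : 'rV[K]_m) : T (psi (lin h1 b x) - phi (lin h1 b (x *m M))).
  have -> : psi (lin h1 b x) - phi (lin h1 b (x *m M)) =
     \sum_(i < m) kact h2 (x 0 i) (psi (b i) - phi (lin h1 b (A i))).
    have [psiD _ _ _ _] := hpsi; have [phiD _ _ _ _] := hphi.
    rewrite (lin_mul bij1) /lin (big_morph psi psiD (hom0 hpsi)).
    rewrite (big_morph phi phiD (hom0 hphi)) -sumrB; apply: eq_bigr => i _.
    rewrite (hom_kact rat1 rat2 _ _ hpsi) (hom_kact rat1 rat2 _ _ hphi) rowK.
    by rewrite (kactBr bij2).
  by apply: (ksub_sum _ kT) => i _; apply: TZ.
have eE (x : 'rV[K]_m) : S (e1 (lin h1 b x) - lin h1 b (map_mx (@kshift C) x *m E)).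
  have -> : e1 (lin h1 b x) - lin h1 b (map_mx (@kshift C) x *m E) =
     \sum_(i < m) kact h1 (kshift (x 0 i)) (e1 (b i) - lin h1 b (E0 i)).
    rewrite e_lin (lin_mul bij1) -sumrB; apply: eq_bigr => i _; rewrite rowK mxE.
    by rewrite (kactBr bij1).
  by apply: (ksub_sum _ kS) => i _; apply: SZ.
have Eu : E \in unitmx.
  rewrite -row_free_unit -kermx_eq0; apply/eqP/row_matrixP => i; rewrite row0.
  have [y yE] := choice (@kshift_surj C).
  (* Shift a kernel row of [E] back to [x]: then [e] sends [lin h1 b x] into [S], so [x = 0] by
     injectivity of [e] modulo [S]. *)
  pose x := map_mx y (row i (kermx E)).
  have xE : map_mx (@kshift C) x = row i (kermx E).
    by apply/rowP => j; rewrite !mxE yE.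
  rewrite -xE; suff -> : x = 0 by apply/rowP => j; rewrite !mxE rmorph0.
  apply: ib; apply: (e_inj_mod act1 rat1 subS).
  by have := eE x; rewrite xE -row_mul mulmx_ker row0 (lin0 bij1) subr0.
have Tsym u v : T (u - v) -> T (v - u).
  by move=> /(TZ (-1)); rewrite (kact_N1 bij2) opprB.
have Ttrans u v w : T (u - v) -> T (v - w) -> T (u - w).
  by move=> Tuv /(TD _ _ Tuv); rewrite addrA subrK.
have comm : map_mx (@kshift C) M *m E = E *m M.
  apply/row_matrixP => i; apply/eqP; rewrite -subr_eq0; apply/eqP.
  rewrite !row_mul -map_row; set x := row i M.
  apply: ib; apply: phi_inj; first exact: Slin.
  rewrite (linB bij1) (homB _ _ hphi).
  have := psiE (delta_mx 0 i); rewrite -rowE -/x => H1.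
  have /Tef[H2 _] := H1.
  have H3 := phiS _ (eE x).
  have H4 := psiS _ (eE (delta_mx 0 i)).
  have H5 := psiE (row i E).
  move: H2 H3 H4; rewrite linearB.
  have [_ _ psie _ _] := hpsi; have [_ _ phie _ _] := hphi; rewrite -psie -phie.
  rewrite map_delta_mx -rowE (homB _ _ hphi) (homB _ _ hpsi) => H2 H3 H4.
  exact: Ttrans (Tsym _ _ H3) (Ttrans _ _ _ (Tsym _ _ H2) (Ttrans _ _ _ H4 H5)).
have [v Sv nTv] : exists2 v, S' v & ~ T (phi v).
  by apply: contrapT => H; apply: nphi => v Sv; apply: contrapT => nT; apply: H; exists v.
have [c rc] : exists c, root (char_poly M) (constK c).
  apply: (poly_root_exists (iota := @constK C)) => [i|].
    apply: kshift_fixed; rewrite -coef_map map_char_poly.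
    by rewrite (char_poly_conj Eu comm).
  (* The characteristic polynomial is constant only for [m = 0], when [S'] would lie in [S]. *)
  rewrite size_char_poly eqSS; apply/eqP => m0; apply: nTv; apply: phiS.
  have [x] := b_span v Sv; suff -> : lin h1 b x = 0 by rewrite subr0.
  by rewrite /lin big1 // => i _; have := leq_trans (ltn_ord i) (eq_leq m0).
exists c; have [x xM x0] : exists2 x : 'rV[K]_m, x *m M = constK c *: x & x != 0.
  by move: rc; rewrite -eigenvalue_root_char => /eigenvalueP.
(* The kernel of [psi - c phi] on [S' / S] contains the eigenvector [x], so by simplicity it is
   everything. *)
have sub := rational_submodule_preimage (hom_comb c hphi hpsi) subS' subT.
have /= [||H|H u Su] := Ssimple _ sub.
- move=> u Su; split; first exact: SS'.
  apply: (ksubB bij2 kT); first exact: psiS.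
  by rewrite -(kact_const bij2); apply/TZ/phiS.
- by move=> u [].
- case/eqP: x0; apply: ib; apply: H; split; first exact: Slin.
  have := psiE x; rewrite xM (linZ bij1) (hom_kact rat1 rat2 _ _ hphi).
  by rewrite (kact_const bij2).
- by have [] := H u Su.
Qed.
End SimpleSteps.

(** * The filtration of the Hom space and the dimension bound *)

(* Passing from [P] to a [Q] of codimension at most [1] loses at most one
   dimension; [d] counts the dimensions lost so far. *)
Lemma rank_filtration_step (F : fieldType) k (P Q : 'rV[F]_k -> Prop) d :
  (forall u w, P u -> ~ Q u -> P w -> exists a, Q (w - a *: u)) ->
  (exists A : 'M[F]_k, (k <= \rank A + d)%N /\ forall i, P (row i A)) ->
  exists A : 'M[F]_k, (k <= \rank A + d.+1)%N /\ forall i, Q (row i A).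
Proof.
move=> PQ [A [kA PA]].
have [H|/existsNP[i0 nQ]] := pselect (forall i, Q (row i A)).
  by exists A; split=> //; rewrite addnS leqW.
have /fin_all_exists[a aE] (i : 'I_k) : exists a, Q (row i A - a *: row i0 A).
  exact: PQ.
(* Subtracting [D], of rank at most one, moves every row into [Q]; the row [i0] outside [Q] serves
   as pivot. *)
pose D := (\col_i a i) *m row i0 A.
exists (A - D); split=> [|i]; last first.
  have -> : row i (A - D) = row i A - a i *: row i0 A.
    by apply/rowP => j; rewrite !mxE big_ord1 !mxE.
  exact: aE.
rewrite addnS -addSn; apply: (leq_trans kA); rewrite leq_add2r -addn1.
rewrite -{1}(subrK D A); apply: (leq_trans (mxrank_add _ _)); rewrite leq_add2l.
exact: leq_trans (mxrankM_maxr _ _) (rank_leq_row _).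
Qed.

Theorem hom_dim_le_length (C : numClosedFieldType)
  (V1 : lmodType C) (e1 f1 h1 : {linear V1 -> V1})
  (V2 : lmodType C) (e2 f2 h2 : {linear V2 -> V2}) n1 n2 :
  is_sl2_action e1 f1 h1 -> is_rational h1 -> is_rational h2 ->
  is_length e1 f1 h1 n1 -> is_length e2 f2 h2 n2 ->
  hom_dim_le e1 f1 h1 e2 f2 h2 (n1 * n2)%N.
Proof.
move=> act1 rat1 rat2 len1 len2 k phis hphis phis_free.
have [[S chS] _] := len1; have [[T chT] _] := len2.
have [_ S0 Sn _] := chS; have [subT T0 Tn _] := chT.
pose phi (c : 'rV[C]_k) v := \sum_(i < k) c 0 i *: phis i v.
have hphi c : is_sl2_hom e1 f1 h1 e2 f2 h2 (phi c).
  split=> [u v|a v|v|v|v]; rewrite /phi ?linear_sum -?big_split /=.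
  - apply: eq_bigr => i _; have [D _ _ _ _] := hphis i.
    by rewrite D scalerDr.
  - apply: eq_bigr => i _; have [_ Z _ _ _] := hphis i.
    by rewrite Z !scalerA mulrC.
  - by apply: eq_bigr => i _; have [_ _ E _ _] := hphis i; rewrite E linearZ.
  - by apply: eq_bigr => i _; have [_ _ _ E _] := hphis i; rewrite E linearZ.
  - by apply: eq_bigr => i _; have [_ _ _ _ E] := hphis i; rewrite E linearZ.
have phiB u w a v : phi (w - a *: u) v = phi w v - a *: phi u v.
  rewrite /phi scaler_sumr -sumrB; apply: eq_bigr => i _.
  by rewrite !mxE scalerBl scalerA.
(* Coefficient vectors are filtered lexicographically: [Z i] kills [S i], and [H i j] moreover sends
   [S i.+1] into [T j]. *)
pose Z i c := forall v, S i v -> phi c v = 0.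
pose H i j c := Z i c /\ forall v, S i.+1 v -> T j (phi c v).
pose large P d := exists A : 'M[C]_k, (k <= \rank A + d)%N /\ forall i, P (row i A).
have large_sub (P Q : 'rV[C]_k -> Prop) d : (forall c, P c -> Q c) -> large P d -> large Q d.
  by move=> PQ [A [kA PA]]; exists A; split=> // i; apply: PQ.
have step i j d : (i < n1)%N -> (j < n2)%N -> large (H i j.+1) d -> large (H i j) d.+1.
  move=> i1 j2; apply: rank_filtration_step => u w [Zu Hu] nHu [Zw Hw].
  have s1 := max_chain_simple len1 chS i1; have s2 := max_chain_simple len2 chT j2.
  have [Tj0 _ _ _ _] := subT j (ltnW j2).
  have [|||||c cE] := simple_step_schur act1 rat1 rat2 s1 s2 (hphi u) (hphi w).
  - by move=> v /Zu ->.
  - by move=> v /Zw ->.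
  - exact: Hu.
  - exact: Hw.
  - by move=> Hu0; apply: nHu; split.
  exists c; split=> v Sv; rewrite phiB; last exact: cE.
  by rewrite Zu // Zw // scaler0 subr0.
have row_step i d : (i < n1)%N -> large (Z i) d -> large (Z i.+1) (d + n2)%N.
  move=> i1 L.
  (* The index descends from [H i n2], which is [Z i] as [T n2] is everything, to [H i 0], which
     gives [Z i.+1] as [T 0] is zero. *)
  suff : forall t, (t <= n2)%N -> large (H i (n2 - t)%N) (d + t)%N.
    move=> /(_ n2 (leqnn _)); apply: large_sub; rewrite subnn => c [_ Hc] v /Hc.
    by move/T0.
  elim=> [_|t IH tn].
    by rewrite subn0 addn0; apply: large_sub L => c Zc; split.
  rewrite addnS; apply: step => //; first by rewrite ltn_subrL; lia.
  by rewrite subnSK //; apply: IH (ltnW tn).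
have [A [kA ZA]] : large (Z n1) (n1 * n2)%N.
  suff : forall i, (i <= n1)%N -> large (Z i) (i * n2)%N by apply.
  elim=> [_|i IH im]; last by rewrite mulSnr; apply: row_step => //; apply: IH (ltnW im).
  exists 1%:M; rewrite mxrank1 addn0; split=> // i v /S0 ->.
  exact: hom0 (hphi _).
(* A combination in [Z n1] vanishes on all of [V1], so freeness kills every row of [A]. *)
suff A0 : A = 0 by move: kA; rewrite A0 mxrank0.
apply/row_matrixP => i; apply/rowP => j; rewrite row0 mxE.
have := phis_free (fun j => row i A 0 j) (fun v => ZA i v (Sn v)) j.
by rewrite /= !mxE.
Qed.

Theorem theorem6p20 (R : realType)
  (V1 : lmodType R[i]) (e1 f1 h1 : {linear V1 -> V1})
  (V2 : lmodType R[i]) (e2 f2 h2 : {linear V2 -> V2}) :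
  is_sl2_action e1 f1 h1 -> is_rational h1 ->
  is_sl2_action e2 f2 h2 -> is_rational h2 ->
  exists n1 n2 : nat,
    [/\ is_length e1 f1 h1 n1, is_length e2 f2 h2 n2
      & hom_dim_le e1 f1 h1 e2 f2 h2 (n1 * n2)%N].
Proof.
move=> act1 rat1 act2 rat2.
have [n1 len1] := length_exists e1 f1 rat1.
have [n2 len2] := length_exists e2 f2 rat2.
by exists n1, n2; split=> //; exact: hom_dim_le_length.
Qed.
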